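(* Let $\ell\ge 3$ be an integer and define $f(3)=2/7$ and $f(\ell)=\frac{3\ell-7}{3\ell-1}$ for $\ell\ge 4$. Then every $\mathcal{K}_{\ell+1}^3$-saturated $3$-graph $\mathcal{H}$ on $n$ vertices with $\delta_2^{+}(\mathcal{H})>f(\ell)n$ is $\ell$-partite.
   Context: A $3$-graph is a set of vertices with a collection of $3$-element subsets (edges). For $\ell\ge 3$, $\mathcal{K}_{\ell+1}^3$ is the family of all $3$-graphs $F$ with at most $\binom{\ell+1}{2}$ edges such that for some $(\ell+1)$-set $S$ of vertices, every pair $\{u,v\}\subset S$ is contained in some edge of $F$. A $3$-graph $\mathcal{H}$ is $\mathcal{K}_{\ell+1}^3$-saturated if it contains no member of $\mathcal{K}_{\ell+1}^3$ as a subgraph, but adding any new triple as an edge creates a subgraph isomorphic to a member of $\mathcal{K}_{\ell+1}^3$. The minimum positive co-degree $\delta_2^+(\mathcal{H})$ of a non-empty $3$-graph $\mathcal{H}$ is the largest $k$ such that every pair of vertices contained in some edge of $\mathcal{H}$ is contained in at least $k$ edges of $\mathcal{H}$. $\mathcal{H}$ is $\ell$-partite if its vertex set can be partitioned into $\ell$ parts so that every edge meets each part in at most one vertex. *)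

(* Defs.v *)
From HB Require Import structures.
From mathcomp Require Import all_boot all_order all_algebra.

Set Implicit Arguments.
Unset Strict Implicit.
Unset Printing Implicit Defensive.

Import Order.TTheory GRing.Theory Num.Theory.

(* A 3-graph on the vertex type V is given by its set of edges. *)
Definition is_3graph (V : finType) (H : {set {set V}}) : Prop :=
  forall e : {set V}, e \in H -> #|e| = 3.

Definition covers_pairs (V : finType) (F : {set {set V}}) (S : {set V}) : Prop :=
  forall u v : V, u \in S -> v \in S -> u != v ->
    exists2 e : {set V}, e \in F & [set u; v] \subset e.

(* inK m F : the 3-graph F belongs to the family K_m^3. *)
Definition inK (m : nat) (V : finType) (F : {set {set V}}) : Prop :=
  [/\ is_3graph F,
      #|F| <= 'C(m, 2)
    & exists2 S : {set V}, #|S| = m & covers_pairs F S].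

(* H contains a (not necessarily induced) copy of F. *)
Definition contains_copy (W V : finType) (F : {set {set W}})
    (H : {set {set V}}) : Prop :=
  exists2 phi : W -> V, injective phi &
    forall e : {set W}, e \in F -> phi @: e \in H.

Definition contains_K (m : nat) (V : finType) (H : {set {set V}}) : Prop :=
  exists (W : finType) (F : {set {set W}}), inK m F /\ contains_copy F H.

Definition K_saturated (m : nat) (V : finType) (H : {set {set V}}) : Prop :=
  ~ contains_K m H /\
  forall e : {set V}, #|e| = 3 -> e \notin H -> contains_K m (e |: H).

Definition codeg (V : finType) (H : {set {set V}}) (u v : V) : nat :=
  #|[set e in H | [set u; v] \subset e]|.

Definition pos_codeg_geq (V : finType) (H : {set {set V}}) (k : nat) : bool :=
  [forall u, forall v, (u != v) ==>
    [exists e in H, [set u; v] \subset e] ==> (k <= codeg H u v)].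

(* The largest k with pos_codeg_geq H k. In a non-empty 3-graph every such k
   is at most some co-degree, hence at most #|V|, so bounding k by #|V| loses
   nothing. The value on the empty 3-graph is 0 by convention. *)
Definition min_pos_codeg (V : finType) (H : {set {set V}}) : nat :=
  if H == set0 then 0
  else \max_(k < #|V|.+1 | pos_codeg_geq H k) k.

(* The parts are the fibres of c; they may be empty. *)
Definition l_partite (l : nat) (V : finType) (H : {set {set V}}) : Prop :=
  exists c : V -> 'I_l, forall (e : {set V}) (i : 'I_l),
    e \in H -> #|[set v in e | c v == i]| <= 1.

Local Open Scope ring_scope.

Definition f_thr (l : nat) : rat :=
  if l == 3%N then 2 / 7 else (3 * l%:R - 7) / (3 * l%:R - 1).

(* Main.v *)
(** Let G be the shadow of H, d its minimum codegree on edges and n the number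
    of vertices. Saturation makes G a graph without (l+1)-clique in which any two
    non-adjacent vertices with a common neighbour have an (l-1)-clique in their
    common neighbourhood; a maximal clique through x yields
    (l-1) d <= (l-2) deg x, so degrees exceed n/2 and common neighbours always
    exist. If non-adjacency is transitive, G is complete multipartite with at
    most l parts. Otherwise there are v and adjacent w1, w2, both non-adjacent to
    v, and (l-1)-cliques s, t in the common neighbourhoods of v, w1 and of v, w2,
    chosen with hub A = s :&: t of maximal size k (Brandt's proof of the
    Andrasfai-Erdos-Sos theorem). Let B be the rim, i.e. v, w1, w2 and the
    symmetric difference of s and t. By maximality every vertex misses a vertex
    of A or three vertices of B. Double counting degrees and codegrees over A and
    B contradicts the codegree hypothesis: for k <= l-3 the weighted degree sum
    3 deg(A) + deg(B) is too large, with the sharper degree bound inside the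
    links of A if k = l-3, and for k = l-2 one counts the codegrees of the pairs
    in A x B (or, if l = 3, of a triangle through A). *)
Require Import Defs.
From mathcomp Require Import all_boot all_order all_algebra.
From mathcomp Require Import zify.

Set Implicit Arguments.
Unset Strict Implicit.
Unset Printing Implicit Defensive.

Import GRing.Theory Num.Theory.

(** * Arithmetic of the degree and codegree sums *)

Lemma leq_sum_const (I : finType) (P : {set I}) (m : nat) (F : I -> nat) :
  {in P, forall i, m <= F i} -> #|P| * m <= \sum_(i in P) F i.
Proof. by move=> mF; rewrite -sum_nat_const; apply: leq_sum. Qed.

Lemma geq_sum_const (I : finType) (P : {set I}) (m : nat) (F : I -> nat) :
  {in P, forall i, F i <= m} -> \sum_(i in P) F i <= #|P| * m.
Proof. by move=> mF; rewrite -sum_nat_const; apply: leq_sum. Qed.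

Lemma geq_sum_allconst (I : finType) (m : nat) (F : I -> nat) :
  (forall i, F i <= m) -> \sum_i F i <= #|I| * m.
Proof. by move=> mF; rewrite -sum_nat_const; apply: leq_sum. Qed.

(* SA and SB are the degree sums over the hub and the rim of a wheel; the
   cases m >= 3, m = 2 and m = 1 use different subsets of the inequalities. *)
Lemma wheel_sums_absurd (l k m n d SA SB : nat) :
  3 <= l -> k + m = l.-1 -> 0 < m ->
  (if l == 3 then 2 * n < 7 * d else (3 * l - 7) * n < (3 * l - 1) * d) ->
  k * (l.-1 * d) <= l.-2 * SA ->
  (2 * m + 3) * (l.-1 * d) <= l.-2 * SB ->
  3 * SA + SB <= n * (3 * k + 2 * m) ->
  k * ((3 * k + 2 * m) * d) <= (3 * k + 2 * m - 3) * SA ->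
  (m = 1 -> 2 <= k -> 5 * k * d + (3 * k - 5) * SA <= n * (3 * (k * (k - 1)))) ->
  (k = 1 -> m = 1 -> d + SA <= n) ->
  False.
Proof.
move=> l3 kml m0 dB hA hB h1 h2 h3 h4.
have [m1|m1|m2] := ltngtP m 2; last 1 first.
(* For [m = 2], [h2] bounds [SA] and [hB] bounds [SB] from below, and [h1] then bounds [d]. Here
   [l = 3] only if [k = 0]. *)
- subst m; have lE : l = k + 3 by lia.
  subst l; have [k0|k0] := posnP k; first by subst k; rewrite /= in dB hA hB h1; lia.
  have nl : (k + 3 == 3) = false by lia.
  have {}dB : (3 * k + 2) * n < (3 * k + 8) * d.
    by rewrite nl in dB; move: dB; congr (_ * _ < _ * _); lia.
  have {}h2 : k * ((3 * k + 4) * d) <= (3 * k + 1) * SA.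
    by move: h2; congr (_ <= _ * _); lia.
  have {}hB : 7 * ((k + 2) * d) <= (k + 1) * SB.
    by move: hB; congr (_ * (_ * _) <= _ * _); lia.
  have g1 := leq_mul (leqnn ((3 * k + 1) * (k + 1))) h1.
  have g2 := leq_mul (leqnn (3 * (k + 1))) h2.
  have g3 := leq_mul (leqnn (3 * k + 1)) hB.
  have g4 : (3 * (k + 1) * (k * (3 * k + 4)) + (3 * k + 1) * (7 * (k + 2))) * d
      <= (3 * k + 1) * (k + 1) * (3 * k + 4) * n by lia.
  have g5 := leq_mul (leqnn (3 * k + 8)) g4.
  set P := 3 * (k + 1) * (k * (3 * k + 4)) + (3 * k + 1) * (7 * (k + 2)) in g5 *.
  have g6 := leq_mul (leqnn P) dB.
  have g7 : P * ((3 * k + 2) * n) + P <=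
            (3 * k + 8) * ((3 * k + 1) * (k + 1) * (3 * k + 4)) * n by lia.
  (* The right side exceeds the left by [18 * k * k - 4], which is positive because [k > 0]. *)
  have g8 : (3 * k + 8) * ((3 * k + 1) * (k + 1) * (3 * k + 4)) <= P * (3 * k + 2).
    by have kk : k <= k * k by [rewrite leq_pmulr]; rewrite /P; lia.
  have P0 : 0 < P by rewrite /P addn_gt0 !muln_gt0 !addn_gt0 !orbT.
  by have g9 := leq_mul g8 (leqnn n); clearbody P; lia.
- have mE : m = 1 by lia.
  subst m; have lE : l = k + 2 by lia.
  subst l; have [k1|k1] := leqP k 1.
    have kE : k = 1 by lia.
    by subst k; have := h4 erefl erefl; rewrite /= in dB h2; lia.
  have nl : (k + 2 == 3) = false by lia.
  have {}dB : (3 * k - 1) * n < (3 * k + 5) * d.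
    by rewrite nl in dB; move: dB; congr (_ * _ < _ * _); lia.
  have {}h3 := h3 erefl k1.
  have {}h2 : k * ((3 * k + 2) * d) <= (3 * k - 1) * SA.
    by move: h2; congr (_ <= _ * _); lia.
  have [j kE] : exists j, k = j + 2 by exists (k - 2); lia.
  have e1 : 3 * k - 1 = 3 * j + 5 by lia.
  have e2 : 3 * k - 5 = 3 * j + 1 by lia.
  have e3 : k - 1 = j + 1 by lia.
  rewrite e1 in dB h2; rewrite e2 e3 in h3; subst k.
  (* The two multipliers cancel [SA] between [h3] and [h2]. What remains is the threshold for
     [l = k + 2] itself, so there is no slack. *)
  have g1 := leq_mul (leqnn (3 * j + 5)) h3.
  have g2 := leq_mul (leqnn (3 * j + 1)) h2.
  have g3 : 3 * ((j + 2) * (j + 1)) * ((3 * j + 11) * d) <=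
            3 * ((j + 2) * (j + 1)) * ((3 * j + 5) * n) by lia.
  rewrite leq_pmul2l in g3; last by rewrite !muln_gt0 !addn_gt0 !orbT.
  have e4 : 3 * (j + 2) + 5 = 3 * j + 11 by lia.
  by move: dB; rewrite e4 ltnNge g3.
have [j mE] : exists j, m = j + 3 by exists (m - 3); lia.
subst m; have lE : l = k + j + 4 by lia.
subst l.
have nl : (k + j + 4 == 3) = false by lia.
have {}dB : (3 * (k + j) + 5) * n < (3 * (k + j) + 11) * d.
  by rewrite nl in dB; move: dB; congr (_ * _ < _ * _); lia.
have {}hA : k * ((k + j + 3) * d) <= (k + j + 2) * SA.
  by move: hA; congr (_ * (_ * _) <= _ * _); lia.
have {}hB : (2 * j + 9) * ((k + j + 3) * d) <= (k + j + 2) * SB.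
  by move: hB; congr (_ * (_ * _) <= _ * _); lia.
have g1 := leq_mul (leqnn (k + j + 2)) h1.
have g4 : (3 * k + (2 * j + 9)) * (k + j + 3) * d <=
          (k + j + 2) * (3 * k + 2 * j + 6) * n by lia.
set P := (3 * k + (2 * j + 9)) * (k + j + 3) in g4 *.
set Q := (k + j + 2) * (3 * k + 2 * j + 6) in g4 *.
have g5 := leq_mul (leqnn (3 * (k + j) + 11)) g4.
have g6 := leq_mul (leqnn P) dB.
have g8 : (3 * (k + j) + 11) * Q <= P * (3 * (k + j) + 5).
  have -> : P * (3 * (k + j) + 5) =
      (3 * (k + j) + 11) * Q + (3 * (k + j) * j + 10 * j + 3 * k + 3).
    by rewrite /P /Q; lia.
  exact: leq_addr.
have P0 : 0 < P by rewrite /P !muln_gt0 !addn_gt0 !orbT.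
by have g9 := leq_mul g8 (leqnn n); clearbody P Q; lia.
Qed.

(** With [D] a degree bounded as in [deg_codeg], this makes any two neighbourhoods meet. For
    [l >= 4] it rests on [2 (l-1) (3l-7) >= (l-2) (3l-1)]. *)
Lemma degree_gt_half (l n d D : nat) : 3 <= l ->
  (if l == 3 then 2 * n < 7 * d else (3 * l - 7) * n < (3 * l - 1) * d) ->
  l.-1 * d <= l.-2 * D -> n < 2 * D.
Proof.
case: l => [|[|[|[|e]]]] //= _ dB h; first lia.
have {}dB : (3 * e + 5) * n < (3 * e + 11) * d.
  by move: dB; congr (_ * _ < _ * _); lia.
rewrite ltnNge; apply/negP => Dn.
have g1 := leq_mul (leqnn (3 * e + 11)) h.
have g2 := leq_mul (leqnn e.+3) dB.
have g3 := leq_mul (leqnn ((3 * e + 11) * e.+2)) Dn.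
have : 2 * (e.+3 * (3 * e + 5)) * n + 2 * e.+3 <= (3 * e + 11) * e.+2 * n by lia.
rewrite leqNgt => /negP; apply.
apply: (@leq_trans (2 * (e.+3 * (3 * e + 5)) * n + 1)); last by rewrite leq_add2l; lia.
rewrite addn1 ltnS; apply: leq_mul => //.
by have -> : 2 * (e.+3 * (3 * e + 5)) =
  (3 * e + 11) * e.+2 + (3 * e * e + 11 * e + 8); [lia|exact: leq_addr].
Qed.

(** * Cliques and double counting in a graph *)

Section Graph.

Variables (V : finType) (adj : rel V).
Hypotheses (adjC : symmetric adj) (adjxx : irreflexive adj).

Definition nbr (x : V) : {set V} := [set y | adj x y].

Definition clique (S : {set V}) : bool :=
  [forall x in S, forall y in S, (x != y) ==> adj x y].

Lemma cliqueP (S : {set V}) :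
  reflect {in S &, forall x y, x != y -> adj x y} (clique S).
Proof.
apply: (iffP forall_inP) => [h x y xS yS xy|h x xS].
  by move/forall_inP: (h x xS) => /(_ y yS) /implyP; apply.
by apply/forall_inP => y yS; apply/implyP; apply: h.
Qed.

Lemma clique1 (x : V) : clique [set x].
Proof. by apply/cliqueP => y z /set1P-> /set1P->; rewrite eqxx. Qed.

Lemma cliqueS (S T : {set V}) : S \subset T -> clique T -> clique S.
Proof.
move=> /subsetP ST /cliqueP cT; apply/cliqueP => x y xS yS.
by apply: cT; apply: ST.
Qed.

Lemma cliqueU1 (x : V) (S : {set V}) :
  S \subset nbr x -> clique S -> clique (x |: S).
Proof.
move=> /subsetP Sx /cliqueP cS; apply/cliqueP => y z.
rewrite !inE => /orP[/eqP->|yS] /orP[/eqP->|zS]; first by rewrite eqxx.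
- by move: (Sx _ zS); rewrite inE.
- by move: (Sx _ yS); rewrite inE adjC.
by apply: cS.
Qed.

(** Both sides count the adjacent pairs between [Q] and [X]. *)
Lemma sum_nbr_inter (X Q : {set V}) :
  \sum_(b in Q) #|X :&: nbr b| = \sum_(x in X) #|nbr x :&: Q|.
Proof.
transitivity (\sum_(b in Q) \sum_(x in X | adj b x) 1).
  apply: eq_bigr => b _; rewrite -sum1_card.
  by apply: eq_bigl => x; rewrite !inE.
rewrite (exchange_big_dep [in X]) /=; last by move=> ? ? _ /andP[].
apply: eq_bigr => x xX; rewrite -sum1_card.
by apply: eq_bigl => b; rewrite !inE xX andbC adjC.
Qed.

Lemma sum_deg (Q : {set V}) :
  \sum_(b in Q) #|nbr b| = \sum_x #|nbr x :&: Q|.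
Proof.
transitivity (\sum_(b in Q) #|setT :&: nbr b|).
  by apply: eq_bigr => b _; rewrite setTI.
by rewrite sum_nbr_inter; apply: eq_bigl => x; rewrite inE.
Qed.

(** Both sides count the triples [a], [b], [x] with [a] in [P], [b] in [Q] and [x] adjacent to
    both. *)
Lemma sum_codeg (P Q : {set V}) :
  \sum_(a in P) \sum_(b in Q) #|nbr a :&: nbr b| =
  \sum_x #|nbr x :&: P| * #|nbr x :&: Q|.
Proof.
under eq_bigr => a _ do rewrite sum_nbr_inter.
rewrite (exchange_big_dep predT) //=.
apply: eq_bigr => x _; rewrite sum_nat_cond_const; congr (_ * _).
by apply: eq_card => a; rewrite !inE andbC adjC.
Qed.

Section CliqueBound.

Variable (l : nat).
Hypothesis cliqueB : forall S, clique S -> #|S| <= l.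

Section MinCodegree.

Variable (d : nat).
Hypothesis codegB : forall x y, adj x y -> d <= #|nbr x :&: nbr y|.

(* Every common neighbour of x and a vertex of a maximal clique C through x
   misses a vertex of C other than x. *)
Lemma deg_codeg (x : V) : 2 <= l -> 0 < d -> 0 < #|nbr x| ->
  l.-1 * d <= l.-2 * #|nbr x|.
Proof.
move=> l2 d0 /card_gt0P[y]; rewrite inE => xy.
have clx : clique [set x] && (x \in [set x]) by rewrite clique1 inE eqxx.
pose P S := clique S && (x \in S).
have [C /maxsetP[/andP[cC xC] maxC] _] := @maxset_exists _ P _ clx.
have cxC : C :\ x \subset nbr x.
  apply/subsetP => z /setD1P[zx zC]; rewrite inE.
  by move/cliqueP: cC; apply; rewrite // eq_sym.
have miss z : z \in nbr x -> #|nbr z :&: (C :\ x)| < #|C :\ x|.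
  rewrite inE => xz; apply: proper_card; rewrite properEneq subsetIr andbT.
  apply/negP => /eqP/setIidPr Cz.
  have CzC : C \subset nbr z.
    apply/subsetP => w wC; have [->|wx] := eqVneq w x; first by rewrite inE adjC.
    by move/subsetP: Cz; apply; rewrite !inE wx.
  have PzC : P (z |: C) by rewrite /P cliqueU1 //= inE xC orbT.
  have zC : z \in C by rewrite -(maxC _ PzC (subsetUr _ _)) setU11.
  by move/subsetP: CzC => /(_ z zC); rewrite inE adjxx.
have lo : #|C :\ x| * d <= \sum_(b in C :\ x) #|nbr x :&: nbr b|.
  by apply: leq_sum_const => b /(subsetP cxC); rewrite inE => /codegB.
have hi : \sum_(z in nbr x) #|nbr z :&: (C :\ x)| <= #|nbr x| * #|C :\ x|.-1.
  by apply: geq_sum_const => z /miss; lia.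
rewrite sum_nbr_inter in lo; have := leq_trans lo hi.
have := cliqueB cC; rewrite (cardsD1 x C) xC.
have y0 : 0 < #|nbr x| by apply/card_gt0P; exists y; rewrite inE.
have [m0|] := posnP #|C :\ x|.
  by have := miss y; rewrite inE xy m0 => /(_ isT).
move: {lo hi miss} #|C :\ x| #|nbr x| y0 => m D D0 m0 ml h.
(* The count [m * d <= D * m.-1] forces [d <= D]. Raising [m] to its bound [l.-1] therefore adds at
   least as much on the right as on the left. *)
have dD : d <= D by rewrite -(leq_pmul2l m0) (leq_trans h) // mulnC leq_mul // leq_pred.
have [e em] : exists e, m = e.+1 by exists m.-1; lia.
have [j jl] : exists j, l = j + e.+2 by exists (l - e.+2); lia.
by subst m l; rewrite /= addnS /= in h *; nia.
Qed.

(** * Weighted counting over a hub and a rim *)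

Section HubRim.

Variables (A B : {set V}) (k m : nat).
Hypotheses (cardA : #|A| = k) (cardB : #|B| = 2 * m + 3).
Hypothesis hubN : {in A, forall u, B :|: A :\ u \subset nbr u}.
Hypothesis rimN : forall x, A \subset nbr x -> 2 < #|B :\: nbr x|.

(** Hub vertices weigh 3 and rim vertices 1, in total [3 * k + 2 * m + 3]. Every [x] misses weight
    at least 3: one hub vertex or three rim vertices. *)
Lemma hub_rim_trade (x : V) :
  3 * #|nbr x :&: A| + #|nbr x :&: B| <= 3 * k + 2 * m.
Proof.
have := cardsID (nbr x) B; have := cardsID (nbr x) A.
rewrite cardA cardB !(setIC _ (nbr x)).
have [/rimN|nAx] := boolP (A \subset nbr x); first lia.
have : 0 < #|A :\: nbr x|.
  by rewrite card_gt0 -subset0 subDset setU0.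
lia.
Qed.

(** The weighted count is repeated inside the link of [u]. It contains [B] and [A :\ u], of total
    weight [3 * k + 2 * m], and each vertex of the link again misses weight at least 3. *)
Lemma hub_deg (u : V) : u \in A ->
  (3 * k + 2 * m) * d <= (3 * k + 2 * m - 3) * #|nbr u|.
Proof.
move=> uA; have /subsetP uN := hubN uA.
have cA : #|A :\ u| = k.-1 by have := cardsD1 u A; rewrite uA cardA => ->.
have k0 : 0 < k by rewrite -cardA; apply/card_gt0P; exists u.
have lA : k.-1 * d <= \sum_(x in nbr u) #|nbr x :&: (A :\ u)|.
  rewrite -sum_nbr_inter -cA; apply: leq_sum_const => b bA.
  by apply: codegB; have := uN b; rewrite inE bA orbT inE; apply.
have lB : (2 * m + 3) * d <= \sum_(x in nbr u) #|nbr x :&: B|.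
  rewrite -sum_nbr_inter -cardB; apply: leq_sum_const => b bB.
  by apply: codegB; have := uN b; rewrite in_setU bB => /(_ isT); rewrite inE.
have : \sum_(x in nbr u) (3 * #|nbr x :&: (A :\ u)| + #|nbr x :&: B|) <=
       #|nbr u| * (3 * k + 2 * m - 3).
  apply: geq_sum_const => x; rewrite inE adjC => xu.
  have := hub_rim_trade x; rewrite (cardsD1 u (nbr x :&: A)) !inE xu uA.
  by rewrite setIDA; lia.
rewrite big_split /= -big_distrr /= [_ * (_ - _)]mulnC.
apply: leq_trans; apply: leq_trans (leq_add (leq_mul (leqnn 3) lA) lB).
by rewrite mulnA -mulnDl leq_mul2r; lia.
Qed.

Lemma hub_rim_absurd :
  3 <= l -> k + m = l.-1 -> 0 < m -> (forall x, 0 < #|nbr x|) ->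
  (if l == 3 then 2 * #|V| < 7 * d
   else (3 * l - 7) * #|V| < (3 * l - 1) * d) -> False.
Proof.
move=> l3 kml m0 nbr0 dB.
have d0 : 0 < d by case: (posnP d) dB => // ->; rewrite !muln0; case: ifP.
have degB x : l.-1 * d <= l.-2 * #|nbr x| by apply: deg_codeg => //; lia.
have adjAB u b : u \in A -> b \in B -> adj u b.
  move=> /hubN/subsetP/(_ b) h bB; move: h.
  by rewrite in_setU bB => /(_ isT); rewrite inE.
apply: (@wheel_sums_absurd l k m #|V| d
  (\sum_(u in A) #|nbr u|) (\sum_(b in B) #|nbr b|)) => //.
- by rewrite big_distrr /= -cardA; apply: leq_sum_const.
- by rewrite big_distrr /= -cardB; apply: leq_sum_const.
- rewrite !sum_deg big_distrr -big_split /=.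
  by apply: geq_sum_allconst => x; apply: hub_rim_trade.
- by rewrite big_distrr /= -{1}cardA; apply: leq_sum_const => u /hub_deg.
- move=> m1 k2.
  have lo : k * (5 * d) <= \sum_(u in A) \sum_(b in B) #|nbr u :&: nbr b|.
    rewrite -{1}cardA; apply: leq_sum_const => u uA.
    have -> : 5 = #|B| by rewrite cardB m1.
    by apply: leq_sum_const => b bB; apply: codegB; apply: adjAB.
  rewrite sum_codeg in lo.
  (* Let [p] and [q] be the numbers of hub and rim neighbours of [x]. The coefficient [3 * k - 5]
     gives the extreme cases [p = k, q = 2] and [p = k - 1, q = 5] the same value
     [3 * (k * (k - 1))]. *)
  have hi : \sum_x
      (#|nbr x :&: A| * #|nbr x :&: B| + (3 * k - 5) * #|nbr x :&: A|) <=
      #|V| * (3 * (k * (k - 1))).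
    apply: geq_sum_allconst => x.
    have := hub_rim_trade x; have := subset_leq_card (subsetIr (nbr x) B).
    have := subset_leq_card (subsetIr (nbr x) A); rewrite cardA cardB m1.
    move: #|_ :&: A| #|_ :&: B| => p q pk q5 pq.
    have [e kE] : exists e, k = e + 2 by exists (k - 2); lia.
    have [-> ->] : 3 * k - 5 = 3 * e + 1 /\ k - 1 = e.+1 by split; lia.
    have [pE|pE] : p = k \/ p <= e.+1 by lia.
      by have q2 : q <= 2 by [lia]; rewrite pE kE; nia.
    suff : p * (5 + (3 * e + 1)) <= e.+1 * (3 * k) by nia.
    by apply: leq_mul => //; lia.
  rewrite big_split /= -big_distrr /= -sum_deg in hi.
  by apply: leq_trans hi; rewrite leq_add2r; lia.
(* For a triangle [u], [b], [z] through the hub vertex [u], a common neighbour of [b] and [z]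
   adjacent to [u] would complete a 4-clique. So at least [d] vertices lie outside [nbr u]. *)
move=> k1 m1; have l3E : l = 3 by lia.
have /cards1P[u Au] : #|A| == 1 by rewrite cardA k1.
have uA : u \in A by rewrite Au inE.
rewrite Au big_set1.
have /card_gt0P[b bB] : 0 < #|B| by rewrite cardB; lia.
have ub := adjAB _ _ uA bB.
have /card_gt0P[z] := leq_trans d0 (codegB ub).
rewrite !inE => /andP[uz bz].
have : #|nbr b :&: nbr z| <= #|~: nbr u|.
  apply/subset_leq_card/subsetP => x; rewrite !inE => /andP[bx zx].
  apply/negP => ux.
  have : clique (x |: (u |: (b |: [set z]))).
    apply: cliqueU1; last (apply: cliqueU1; last (apply: cliqueU1; last exact: clique1)).
    - by rewrite !subUset !sub1set !inE !(adjC x) ux bx zx.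
    - by rewrite !subUset !sub1set !inE ub uz.
    - by rewrite sub1set inE.
  move/cliqueB; rewrite !cardsU1 cards1 l3E !inE.
  have neq y y' : adj y y' -> y != y' by apply: contraTneq => ->; rewrite adjxx.
  by rewrite !negb_or !neq // adjC.
have := codegB bz; have := cardsC (nbr u); lia.
Qed.

End HubRim.

End MinCodegree.

(* Brandt's 5-wheel-like graphs: since v |: s, w1 |: s, v |: t and w2 |: t are
   l-cliques and w1, w2 are adjacent, they are not l-colourable. *)
Definition wheel (v w1 w2 : V) (s t : {set V}) : bool :=
  [&& adj w1 w2, ~~ adj v w1 & ~~ adj v w2] &&
  [&& clique s, #|s| == l.-1 & s \subset nbr v :&: nbr w1] &&
  [&& clique t, #|t| == l.-1 & t \subset nbr v :&: nbr w2].

Definition rim (v w1 w2 : V) (s t : {set V}) : {set V} :=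
  [set v; w1; w2] :|: (s :\: t) :|: (t :\: s).

(** * The structure of a wheel with a largest hub *)

Section Wheel.

Variables (v w1 w2 : V) (s t : {set V}).
Hypothesis l0 : 0 < l.
Hypothesis Wst : wheel v w1 w2 s t.
Hypothesis maxW :
  forall s' t', wheel v w1 w2 s' t' -> #|s' :&: t'| <= #|s :&: t|.

Let A := s :&: t.
Let B := rim v w1 w2 s t.

Lemma wheel_facts :
  [/\ [/\ adj w1 w2, ~~ adj v w1 & ~~ adj v w2],
      [/\ clique s, #|s| = l.-1, s \subset nbr v & s \subset nbr w1]
    & [/\ clique t, #|t| = l.-1, t \subset nbr v & t \subset nbr w2]].
Proof.
case/andP: Wst => /andP[/and3P[-> -> ->] /and3P[-> /eqP-> ss]].
case/and3P => -> /eqP-> tt.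
by move: ss tt; rewrite !subsetI => /andP[-> ->] /andP[-> ->].
Qed.

Lemma wheel_neq : [/\ v != w1, v != w2 & w1 != w2].
Proof.
have [[w12 vw1 vw2] _ _] := wheel_facts; split; apply/eqP => e.
- by rewrite e w12 in vw2.
- by rewrite e adjC w12 in vw1.
by rewrite e adjxx in w12.
Qed.

Lemma wheel_notin :
  [/\ (v \in s = false) * (v \in t = false),
      (w1 \in s = false) * (w1 \in t = false)
    & (w2 \in s = false) * (w2 \in t = false)].
Proof.
have [[w12 vw1 vw2] [_ _ /subsetP sv /subsetP sw] [_ _ /subsetP tv /subsetP tw]]
  := wheel_facts.
by do 2![split]; apply/negP => h;
  [have := sv _ h|have := tv _ h|have := sw _ h|have := tv _ h
  |have := sv _ h|have := tw _ h];
  rewrite inE ?adjxx ?(negPf vw1) ?(negPf vw2).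
Qed.

(** Otherwise [s = t], and [w1], [w2] and [s] form a clique with [l + 1] vertices. *)
Lemma card_hub_lt : #|A| < l.-1.
Proof.
have [[w12 vw1 vw2] [cs cards sv sw] [ct cardt tv tw]] := wheel_facts.
rewrite -cards ltnNge; apply/negP => le_sA.
have/setIidPl st : s :&: t = s by apply/eqP; rewrite eqEcard subsetIl.
have sw2 := subset_trans st tw.
have cl : clique (w1 |: (w2 |: s)).
  apply: cliqueU1; last exact: cliqueU1.
  by rewrite subUset sw andbT sub1set inE.
have := cliqueB cl; rewrite !cardsU1 cards !inE.
have [_ _ nw12] := wheel_neq; rewrite negb_or nw12.
by have [_ [-> _] [-> _]] := wheel_notin; rewrite !add1n prednK // ltnn.
Qed.

Lemma card_rim : #|B| = 2 * (l.-1 - #|A|) + 3.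
Proof.
have [_ [_ cards _ _] [_ cardt _ _]] := wheel_facts.
have d1 : [set v; w1; w2] :&: (s :\: t :|: t :\: s) = set0.
  apply/setP => z; rewrite inE [RHS]inE; apply/negP => /andP[].
  rewrite !inE -orbA; have [hv hw1 hw2] := wheel_notin.
  by move=> /or3P[]/eqP->; rewrite ?hv ?hw1 ?hw2.
have d2 : (s :\: t) :&: (t :\: s) = set0.
  by apply/setP => z; rewrite !inE; case: (z \in s); case: (z \in t).
rewrite /B /rim -setUA cardsU d1 (cardsU (s :\: t)) d2 !cardsD cards cardt.
rewrite (setIC t s) cards0 !subn0.
have [vw1 vw2 w12] := wheel_neq.
rewrite -setUA cardsU1 cards2 !inE negb_or vw1 vw2 w12 /A; lia.
Qed.

Lemma hub_adj_rim (u : V) : u \in A -> B :|: A :\ u \subset nbr u.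
Proof.
have [_ [/cliqueP cs _ /subsetP sv /subsetP sw]
        [/cliqueP ct _ /subsetP tv /subsetP tw]] := wheel_facts.
case/setIP => us ut; apply/subsetP => z; rewrite !inE.
have uv : adj u v by move: (sv _ us); rewrite inE adjC.
have uw1 : adj u w1 by move: (sw _ us); rewrite inE adjC.
have uw2 : adj u w2 by move: (tw _ ut); rewrite inE adjC.
have [->|zu] := eqVneq z u.
  rewrite us ut !orbF => /orP[/orP[]|] /eqP e; by rewrite {2}e.
case zs : (z \in s); first by move=> _; apply: cs; rewrite // eq_sym.
case zt : (z \in t); first by move=> _; apply: ct; rewrite // eq_sym.
by rewrite !orbF => /orP[/orP[]|] /eqP->.
Qed.

(* If x sees all of s :&: t, it misses a vertex of each of the l-cliques
   v |: s, w1 |: s, v |: t, w2 |: t.  If it misses only two vertices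
   a in s and b in t of the rim, then x |: s :\ a and x |: t :\ b
   form a wheel with a larger hub. *)
Lemma rim_missed (x : V) : A \subset nbr x -> 2 < #|B :\: nbr x|.
Proof.
have [[w12 vw1 vw2] [cs cards sv sw] [ct cardt tv tw]] := wheel_facts.
have [nvw1 nvw2 nw12] := wheel_neq.
have [[vs vt] [w1s w1t] [w2s w2t]] := wheel_notin.
move=> /subsetP Ax.
have Ax' z : z \in s -> z \in t -> adj x z.
  by move=> zs zt; have := Ax z; rewrite !inE zs zt; apply.
have miss (S : {set V}) z : clique S -> #|S| = l.-1 -> S \subset nbr z ->
    exists2 y, y \in z |: S & ~~ adj x y.
  move=> cS cardS Sz; apply/exists_inP; rewrite -[X in is_true X]negbK; apply/negP.
  rewrite negb_exists_in => /forall_inP h.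
  have xzS : z |: S \subset nbr x.
    by apply/subsetP => y /h; rewrite negbK inE.
  have := cliqueB (cliqueU1 xzS (cliqueU1 Sz cS)).
  rewrite cardsU1 cardsU1 cardS.
  have -> : x \notin z |: S.
    by apply/negP => /(subsetP xzS); rewrite inE adjxx.
  have -> : z \notin S by apply/negP => /(subsetP Sz); rewrite inE adjxx.
  by rewrite !add1n prednK // ltnn.
have sub3 a b c : a != b -> a != c -> b != c -> a \in B -> b \in B -> c \in B ->
    ~~ adj x a -> ~~ adj x b -> ~~ adj x c -> 2 < #|B :\: nbr x|.
  move=> ab ac bc aB bB cB xa xb xc.
  have : [set a; b; c] \subset B :\: nbr x.
    by rewrite !subUset !sub1set !in_setD aB bB cB !inE xa xb xc.
  by move/subset_leq_card; rewrite -setUA cardsU1 cards2 !inE negb_or ab ac bc.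
(* If [x] misses [v], the vertices it misses in [w1 |: s] and in [w2 |: t] are two more. They are
   distinct because neither lies in the hub, [w1] is not in [t] and [w2] is not in [s]. *)
have [xv|xv] := boolP (adj x v); last first.
  have [y1 y1s xy1] := miss s w1 cs cards sw.
  have [y2 y2t xy2] := miss t w2 ct cardt tw.
  have y1P : (y1 == w1) || (y1 \in s) && (y1 \notin t).
    move: y1s; rewrite !inE; case: (y1 == w1) => //= y1s.
    by rewrite y1s; apply: contra xy1 => /(Ax' _ y1s).
  have y2P : (y2 == w2) || (y2 \in t) && (y2 \notin s).
    move: y2t; rewrite !inE; case: (y2 == w2) => //= y2t.
    by rewrite y2t; apply: contra xy2 => y2s; apply: Ax'.
  apply: (sub3 v y1 y2) => //.
  - by case/orP: y1P => [/eqP->//|/andP[h _]]; apply: contraTneq h => <-; rewrite vs.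
  - by case/orP: y2P => [/eqP->//|/andP[h _]]; apply: contraTneq h => <-; rewrite vt.
  - case/orP: y1P => [/eqP->|/andP[h1 h1']]; case/orP: y2P => [/eqP->//|/andP[h2 h2']].
    + by apply: contraTneq h2 => <-; rewrite w1t.
    + by apply: contraTneq h1 => ->; rewrite w2s.
    + by apply: contraTneq h1 => ->.
  - by rewrite !inE eqxx.
  - by case/orP: y1P => [/eqP->|/andP[h1 h1']]; rewrite !inE ?eqxx ?h1 ?h1' ?orbT.
  - by case/orP: y2P => [/eqP->|/andP[h1 h1']]; rewrite !inE ?eqxx ?h1 ?h1' ?orbT.
have [a] := miss s v cs cards sv; rewrite !inE => /orP[/eqP->|a_s xa].
  by rewrite xv.
have [b] := miss t v ct cardt tv; rewrite !inE => /orP[/eqP->|b_t xb].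
  by rewrite xv.
have a_t : a \notin t by apply: contra xa; apply: Ax'.
have b_s : b \notin s by apply: contra xb => ?; apply: Ax'.
rewrite ltnNge; apply/negP => le2.
have ab : a != b by apply: contraTneq a_s => ->.
have BE : [set a; b] = B :\: nbr x.
  apply/eqP; rewrite eqEcard cards2 ab le2 andbT subUset !sub1set !inE.
  by rewrite xa xb a_s a_t b_s b_t !orbT.
have Bx z : z \in B -> z != a -> z != b -> adj x z.
  move=> zB za zb; apply/negPn/negP => xz.
  have : z \in B :\: nbr x by rewrite in_setD zB inE xz.
  by rewrite -BE !inE (negPf za) (negPf zb).
have sx : s :\ a \subset nbr x.
  apply/subsetP => z /setD1P[za zs]; rewrite inE.
  have [zt|zt] := boolP (z \in t); first exact: Ax'.
  by apply: Bx; rewrite ?inE ?zs ?zt ?orbT //; apply: contraTneq zs => ->.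
have tx : t :\ b \subset nbr x.
  apply/subsetP => z /setD1P[zb zt]; rewrite inE.
  have [zs|zs] := boolP (z \in s); first exact: Ax'.
  by apply: Bx; rewrite ?inE ?zs ?zt ?orbT //; apply: contraTneq zt => ->.
have xs : x \notin s :\ a by apply/negP => /(subsetP sx); rewrite inE adjxx.
have xt : x \notin t :\ b by apply/negP => /(subsetP tx); rewrite inE adjxx.
have xA : x \notin A by apply/negP => /Ax; rewrite inE adjxx.
have xw1 : adj x w1.
  apply: Bx; rewrite ?inE ?eqxx ?orbT //; first by apply: contraTneq a_s => <-; rewrite w1s.
  by apply: contraTneq b_t => <-; rewrite w1t.
have xw2 : adj x w2.
  apply: Bx; rewrite ?inE ?eqxx ?orbT //; first by apply: contraTneq a_s => <-; rewrite w2s.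
  by apply: contraTneq b_t => <-; rewrite w2t.
have W' : wheel v w1 w2 (x |: (s :\ a)) (x |: (t :\ b)).
  rewrite /wheel w12 vw1 vw2 /=.
  rewrite !cliqueU1 ?(cliqueS (subsetDl _ _)) //= !cardsU1 xs xt.
  have := cardsD1 a s; have := cardsD1 b t; rewrite a_s b_t cards cardt => <- <-.
  rewrite !eqxx /= !subsetI !subUset !sub1set !inE !(adjC _ x) xv xw1 xw2 /=.
  by rewrite !(subset_trans (subsetDl _ _)).
have := maxW W'; rewrite leqNgt => /negP; apply.
have <- : #|x |: A| = #|s :&: t|.+1 by rewrite cardsU1 xA.
apply/subset_leq_card/subsetP => z; rewrite !inE => /orP[->//|/andP[zs zt]].
rewrite zs zt !andbT.
have -> : z != a by apply: contraTneq zt => ->.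
by have -> : z != b by [apply: contraTneq zs => ->]; rewrite orbT.
Qed.

End Wheel.

(** A maximal clique [C] meets every class of non-adjacency, so each [x] has a non-neighbour in [C],
    whose index is its colour. Two vertices with the same non-neighbour are non-adjacent by
    transitivity. *)
Lemma colouring_of_nonadj_trans : 0 < l ->
  (forall v w1 w2, ~~ adj v w1 -> ~~ adj v w2 -> ~~ adj w1 w2) ->
  exists c : V -> 'I_l, forall x y, adj x y -> c x != c y.
Proof.
move=> l0 tr.
have cl0 : clique set0 by apply/cliqueP => x y; rewrite inE.
have [C /maxsetP[cC maxC] _] := @maxset_exists _ clique _ cl0.
have exf x : {c | c \in C & ~~ adj x c}.
  apply: sig2W; apply/exists_inP; rewrite -[X in is_true X]negbK; apply/negP.
  rewrite negb_exists_in => /forall_inP h.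
  have Cx : C \subset nbr x by apply/subsetP => z /h; rewrite negbK inE.
  have xC : x \in C by rewrite -(maxC _ (cliqueU1 Cx cC) (subsetUr _ _)) setU11.
  by have := subsetP Cx x xC; rewrite inE adjxx.
pose f x := s2val (exf x).
have fC x : f x \in C := s2valP (exf x).
have fN x : ~~ adj x (f x) := s2valP' (exf x).
have idx x : index (f x) (enum C) < l.
  by apply: leq_trans (cliqueB cC); rewrite cardE index_mem mem_enum.
exists (fun x => Ordinal (idx x)) => x y xy; apply/eqP => -[fxy].
have ff : f x = f y.
  rewrite -(@nth_index _ x (f x) (enum C)) ?mem_enum // fxy nth_index //.
  by rewrite mem_enum.
by have := tr (f x) x y; rewrite xy adjC fN adjC ff fN => /(_ isT isT).
Qed.

(** The purely graph-theoretic core, to be applied to the shadow of a saturated 3-graph. *)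
Lemma saturated_colouring (d : nat) : 3 <= l ->
  (forall x y, adj x y -> d <= #|nbr x :&: nbr y|) ->
  (forall x, 0 < #|nbr x|) ->
  (forall x y z, x != y -> ~~ adj x y -> adj x z -> adj y z ->
    exists S, [/\ clique S, #|S| = l.-1 & S \subset nbr x :&: nbr y]) ->
  (if l == 3 then 2 * #|V| < 7 * d
   else (3 * l - 7) * #|V| < (3 * l - 1) * d) ->
  exists c : V -> 'I_l, forall x y, adj x y -> c x != c y.
Proof.
move=> l3 codegB nbr0 sat dB.
have l0 : 0 < l by lia.
have d0 : 0 < d by case: (posnP d) dB => // ->; rewrite !muln0; case: ifP.
have half x : #|V| < 2 * #|nbr x|.
  by apply: (degree_gt_half l3 dB); apply: deg_codeg => //; lia.
(* Two neighbourhoods of more than half of the vertices intersect, so the common neighbour [z] can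
   always be supplied. *)
have {}sat x y : x != y -> ~~ adj x y ->
    exists S, [/\ clique S, #|S| = l.-1 & S \subset nbr x :&: nbr y].
  move=> xy nxy; have /card_gt0P[z] : 0 < #|nbr x :&: nbr y|.
    have := cardsUI (nbr x) (nbr y).
    have := subset_leq_card (subsetT (nbr x :|: nbr y)); rewrite cardsT.
    have := half x; have := half y; lia.
  by rewrite !inE => /andP[xz yz]; apply: (sat x y z).
apply: colouring_of_nonadj_trans => // v w1 w2 vw1 vw2.
apply/negP => w12.
have nvw1 : v != w1 by apply: contraTneq w12 => <-.
have nvw2 : v != w2 by apply: contraTneq w12 => <-; rewrite adjC.
have [s0 [cs0 cards0 s0N]] := sat _ _ nvw1 vw1.
have [t0 [ct0 cardt0 t0N]] := sat _ _ nvw2 vw2.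
have W0 : wheel v w1 w2 s0 t0.
  by rewrite /wheel w12 vw1 vw2 cs0 ct0 cards0 cardt0 s0N t0N !eqxx.
(* The hub is maximised with [v], [w1], [w2] fixed; the exchange in [rim_missed] changes only [s]
   and [t]. *)
pose P := [pred p : {set V} * {set V} | wheel v w1 w2 p.1 p.2].
have [[s t] /= Wst maxst] :=
  @arg_maxnP _ (s0, t0) P (fun p => #|p.1 :&: p.2|) W0.
have maxW s' t' : wheel v w1 w2 s' t' -> #|s' :&: t'| <= #|s :&: t|.
  by move=> W'; apply: (maxst (s', t')).
have hub_lt := card_hub_lt l0 Wst.
apply: (@hub_rim_absurd d codegB (s :&: t) (rim v w1 w2 s t) #|s :&: t|
  (l.-1 - #|s :&: t|)) => //.
- exact: card_rim.
- by move=> u; apply: hub_adj_rim.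
- by move=> x; apply: rim_missed.
- by rewrite subnKC // ltnW.
- by rewrite subn_gt0.
Qed.

End CliqueBound.
End Graph.

(** * The shadow graph of a 3-graph *)

Section Shadow.

Variables (V : finType).
Implicit Types (H : {set {set V}}).

Definition shadow H : rel V :=
  fun u v => (u != v) && [exists e in H, [set u; v] \subset e].

Lemma shadowP H u v :
  reflect (u != v /\ exists2 e, e \in H & (u \in e) && (v \in e)) (shadow H u v).
Proof.
apply: (iffP andP) => -[-> h]; split => //.
  by case/exists_inP: h => e eH; rewrite subUset !sub1set; exists e.
by case: h => e eH uv; apply/exists_inP; exists e; rewrite // subUset !sub1set.
Qed.

Lemma shadowC H : symmetric (shadow H).
Proof. by move=> u v; rewrite /shadow eq_sym setUC. Qed.

Lemma shadowxx H : irreflexive (shadow H).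
Proof. by move=> u; rewrite /shadow eqxx. Qed.

Lemma shadowU1 H e u v :
  shadow (e |: H) u v -> shadow H u v \/ (u \in e) && (v \in e).
Proof.
case/shadowP => uv [e' /setU1P[->|e'H] h]; [by right|left].
by apply/shadowP; split=> //; exists e'.
Qed.

Lemma contains_K_clique (m : nat) H :
  contains_K m H -> exists2 S, clique (shadow H) S & #|S| = m.
Proof.
move=> [W [F [[_ _ [S cardS covS]] [phi phiI phiH]]]].
exists (phi @: S); last by rewrite card_imset.
apply/cliqueP => _ _ /imsetP[u uS ->] /imsetP[v vS ->] uv.
have nuv : u != v by apply: contraNneq uv => ->.
have [e eF] := covS u v uS vS nuv; rewrite subUset !sub1set => /andP[ue ve].
by apply/shadowP; split => //; exists (phi @: e); rewrite ?phiH ?imset_f.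
Qed.

(* One edge is chosen for each of the 'C(m, 2) pairs of the clique. *)
Lemma clique_contains_K H (S : {set V}) :
  is_3graph H -> clique (shadow H) S -> contains_K #|S| H.
Proof.
move=> hH /cliqueP cS.
pose pairs := [set p : {set V} | p \subset S & #|p| == 2].
pose f (p : {set V}) := odflt set0 [pick e in H | p \subset e].
have fP p : p \in pairs -> f p \in H /\ p \subset f p.
  move=> /[!inE] /andP[pS /cards2P[u [v [uv pE]]]]; rewrite /f.
  case: pickP => [e /andP[]//|none]; move: pS; rewrite pE subUset !sub1set.
  case/andP=> uS vS; have /shadowP[_ [e eH uve]] := cS u v uS vS uv.
  by have := none e; rewrite eH pE subUset !sub1set uve.
have FH e : e \in f @: pairs -> e \in H by case/imsetP => p /fP[? _] ->.
exists V, (f @: pairs); split; last first.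
  by exists id => // e /FH; rewrite imset_id.
split; first by move=> e /FH /hH.
  by rewrite (leq_trans (leq_imset_card _ _)) // cards_draws.
exists S => // u v uS vS uv.
have puv : [set u; v] \in pairs by rewrite inE subUset !sub1set uS vS cards2 uv.
by exists (f [set u; v]); [apply: imset_f|case: (fP _ puv)].
Qed.

(** An edge through [u] and [v] is determined by its third vertex, a common neighbour in the shadow.
    Equality can fail, since a triangle of the shadow may be no edge. *)
Lemma codeg_leq_shadow H u v : is_3graph H -> u != v ->
  codeg H u v <= #|nbr (shadow H) u :&: nbr (shadow H) v|.
Proof.
move=> hH uv; rewrite /codeg.
apply: leq_trans (leq_imset_card (fun z => [set u; v; z]) _).
apply/subset_leq_card/subsetP => e; rewrite inE => /andP[eH uve].
have /cards1P[z zE] : #|e :\: [set u; v]| == 1.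
  by rewrite cardsDS // hH // cards2 uv.
have : z \in e :\: [set u; v] by rewrite zE inE.
rewrite !inE negb_or => /andP[/andP[zu zv] ze].
move: (uve); rewrite subUset !sub1set => /andP[ue ve].
apply/imsetP; exists z; last first.
  apply/setP => w; rewrite in_setU -zE in_setD.
  by have [/(subsetP uve)->|] := boolP (w \in [set u; v]).
by rewrite !inE; apply/andP; split; apply/shadowP; split;
  rewrite 1?eq_sym //; exists e; rewrite // ?ue ?ve ze.
Qed.

Lemma min_pos_codeg_leq H u v :
  shadow H u v -> min_pos_codeg H <= codeg H u v.
Proof.
rewrite /min_pos_codeg => /andP[uv ex]; case: ifP => // _.
(* The property holds at 0 and passes to the larger of two values, hence to the maximum. *)
have : pos_codeg_geq H (\max_(k < #|V|.+1 | pos_codeg_geq H k) k).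
  apply: (big_ind (fun k => pos_codeg_geq H k)) => //.
    by apply/'forall_forallP => x y; rewrite leq0n !implybT.
  by move=> a b Ha Hb; case: (leqP a b).
by move/'forall_forallP => /(_ u v); rewrite uv ex.
Qed.

End Shadow.

(** * Consequences of saturation for the shadow *)

Section Saturated.

Variables (l : nat) (V : finType) (H : {set {set V}}).
Hypotheses (l3 : 3 <= l) (hH : is_3graph H) (hsat : K_saturated l.+1 H).

Lemma saturated_clique (S : {set V}) : clique (shadow H) S -> #|S| <= l.
Proof.
move=> cS; rewrite leqNgt; apply/negP => lS; case: hsat => nK _; apply: nK.
have [T TS cT] : exists2 T : {set V}, T \subset S & #|T| = l.+1.
  have : 0 < #|[set B : {set V} | B \subset S & #|B| == l.+1]|.
    by rewrite cards_draws bin_gt0.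
  by case/card_gt0P => T; rewrite inE => /andP[TS /eqP cT]; exists T.
by rewrite -cT; apply: clique_contains_K => //; apply: cliqueS cS.
Qed.

Lemma saturated_new_clique (e : {set V}) : #|e| = 3 -> e \notin H ->
  exists2 S, clique (shadow (e |: H)) S & #|S| = l.+1.
Proof. by case: hsat => _ h e3 eH; apply/contains_K_clique/h. Qed.

(** If [x] were isolated, adding [x] to two vertices [y], [z] of an edge would create a clique of
    size [l + 1]. Through [x] it has at most 3 vertices; avoiding [x] it is already a clique of the
    shadow, as [y] and [z] are adjacent. *)
Lemma saturated_nonisolated (x : V) : H != set0 -> 0 < #|nbr (shadow H) x|.
Proof.
case/set0Pn => e0 e0H; rewrite card_gt0; apply/negP => /eqP Nx.
have nx y : shadow H x y = false.
  by apply/negP => xy; have := in_set0 y; rewrite -Nx inE xy.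
have /card_gt1P[y [z [ye ze yz]]] : 1 < #|e0| by rewrite hH.
have yzH : shadow H y z by apply/shadowP; split=> //; exists e0; rewrite ?ye.
have xe0 w : w \in e0 -> x != w.
  move=> we; apply/eqP => xw; have [xy|xy] := eqVneq x y.
    by have := nx z; rewrite xy yzH.
  by have /shadowP[] := negbT (nx y); split=> //; exists e0; rewrite // xw we.
have e3 : #|[set x; y; z]| = 3 by rewrite -setUA cardsU1 cards2 !inE negb_or !xe0 // yz.
have eH : [set x; y; z] \notin H.
  apply/negP => eH; have /shadowP[] := negbT (nx y); split; first exact: xe0.
  by exists [set x; y; z]; rewrite // !inE !eqxx !orbT.
have [S /cliqueP cS cardS] := saturated_new_clique e3 eH.
have [xS|xS] := boolP (x \in S).
  have : S \subset [set x; y; z].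
    apply/subsetP => w wS; have [->|wx] := eqVneq w x; first by rewrite !inE eqxx.
    have := cS x w xS wS; rewrite eq_sym => /(_ wx) /shadowU1[|/andP[]//].
    by rewrite nx.
  by move/subset_leq_card; rewrite cardS e3; lia.
have : clique (shadow H) S.
  apply/cliqueP => u v uS vS uv; have [//|] := shadowU1 (cS u v uS vS uv).
  have ux : u != x by apply: contraNneq xS => <-.
  have vx : v != x by apply: contraNneq xS => <-.
  rewrite !inE (negPf ux) (negPf vx) /= => /andP[/orP[]/eqP uE /orP[]/eqP vE];
    move: uv; rewrite uE vE ?eqxx // => _; by rewrite // shadowC.
by move/saturated_clique; rewrite cardS ltnn.
Qed.

(** With [z] adjacent to both, the new triple adds only the pair [x], [y] to the shadow. The
    resulting [(l+1)]-clique must contain [x] and [y]; removing them leaves [S]. *)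
Lemma saturated_common_clique (x y z : V) : x != y -> ~~ shadow H x y ->
  shadow H x z -> shadow H y z ->
  exists S, [/\ clique (shadow H) S, #|S| = l.-1
    & S \subset nbr (shadow H) x :&: nbr (shadow H) y].
Proof.
move=> xy nxy xz yz.
have [nxz nyz] : x != z /\ y != z by split; [case/andP: xz|case/andP: yz].
have e3 : #|[set x; y; z]| = 3.
  by rewrite -setUA cardsU1 cards2 !inE negb_or xy nxz nyz.
have eH : [set x; y; z] \notin H.
  apply: contra nxy => eH; apply/shadowP; split=> //.
  by exists [set x; y; z]; rewrite // !inE !eqxx !orbT.
have [S /cliqueP cS cardS] := saturated_new_clique e3 eH.
have adjS u v : u \in S -> v \in S -> u != v ->
    shadow H u v \/ [set u; v] = [set x; y].
  move=> uS vS uv; have [|] := shadowU1 (cS u v uS vS uv); first by left.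
  rewrite !inE -!orbA => /andP[/or3P[]/eqP uE /or3P[]/eqP vE];
    move: uv; rewrite uE vE ?eqxx // => _;
    by [left|left; rewrite shadowC|right|right; rewrite setUC].
have inS w : w \in [set x; y] -> w \in S.
  move=> wxy; apply/negPn/negP => wS.
  suff /saturated_clique : clique (shadow H) S by rewrite cardS ltnn.
  apply/cliqueP => u v uS vS uv; have [//|uvE] := adjS u v uS vS uv.
  by move: wxy; rewrite -uvE => /set2P[] wE; rewrite wE ?uS ?vS in wS.
have xS : x \in S by apply: inS; rewrite !inE eqxx.
have yS : y \in S by apply: inS; rewrite !inE eqxx orbT.
have adjS' u v : u \in S -> v \in S -> v != x -> v != y -> u != v -> shadow H u v.
  move=> uS vS vx vy uv; have [//|/setP/(_ v)] := adjS u v uS vS uv.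
  by rewrite !inE eqxx orbT (negPf vx) (negPf vy).
exists (S :\: [set x; y]); split.
- apply/cliqueP => u v; rewrite !inE !negb_or => /andP[_ uS] /andP[/andP[vx vy] vS].
  exact: adjS'.
- rewrite cardsDS; first by rewrite cardS cards2 xy; lia.
  by rewrite subUset !sub1set xS.
apply/subsetP => v; rewrite !inE negb_or => /andP[/andP[vx vy] vS].
by rewrite !adjS' // eq_sym.
Qed.

End Saturated.

(** * From the shadow back to the 3-graph *)

Lemma l_partite_shadow (l : nat) (V : finType) (H : {set {set V}})
    (c : V -> 'I_l) :
  (forall x y, shadow H x y -> c x != c y) -> l_partite l H.
Proof.
move=> hc; exists c => e i eH; rewrite leqNgt; apply/negP.
case/card_gt1P => x [y []]; rewrite !inE => /andP[xe /eqP cx] /andP[ye /eqP cy] xy.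
have : shadow H x y by apply/shadowP; split=> //; exists e; rewrite ?xe.
by move/hc; rewrite cx cy eqxx.
Qed.

(** Denominators are cleared; the subtractions on naturals are exact because [l >= 3]. *)
Lemma f_thr_nat (l n d : nat) : 3 <= l ->
  (f_thr l * n%:R < d%:R)%R ->
  if l == 3 then 2 * n < 7 * d else (3 * l - 7) * n < (3 * l - 1) * d.
Proof.
rewrite /f_thr => l3; case: eqP => [_|l3'].
  by rewrite mulrAC ltr_pdivrMr // [(_ * 7)%R]mulrC -!natrM ltr_nat.
have -> : (3 * l%:R - 7 = (3 * l - 7)%:R :> rat)%R by rewrite natrB ?natrM //; lia.
have -> : (3 * l%:R - 1 = (3 * l - 1)%:R :> rat)%R by rewrite natrB ?natrM //; lia.
rewrite mulrAC ltr_pdivrMr ?ltr0n; last by lia.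
by rewrite [(d%:R * _)%R]mulrC -!natrM ltr_nat.
Qed.

Theorem theorem1p6 (l : nat) (hl : (3 <= l)%N) (V : finType)
    (H : {set {set V}}) (hH : is_3graph H) (hsat : K_saturated l.+1 H)
    (hdeg : (f_thr l * (#|V|)%:R < (min_pos_codeg H)%:R)%R) :
  l_partite l H.
Proof.
have dB := f_thr_nat hl hdeg.
(* The empty 3-graph has [min_pos_codeg] 0 by convention, which the strict bound excludes. *)
have H0 : H != set0.
  apply/eqP => H0; move: dB; rewrite /min_pos_codeg H0 eqxx !muln0 !ltn0.
  by case: ifP.
have [|||||||c hc] := @saturated_colouring V (shadow H) _ _ l _ (min_pos_codeg H) hl.
- exact: shadowC.
- exact: shadowxx.
- exact: saturated_clique.
- move=> x y xy; apply: leq_trans (min_pos_codeg_leq xy) _.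
  by apply: codeg_leq_shadow => //; case/andP: xy.
- by move=> x; apply: (saturated_nonisolated hl hH hsat).
- exact: (saturated_common_clique hl hH hsat).
- exact: dB.
exact: l_partite_shadow hc.
Qed.
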